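(* Let $k\geq 2$ be an integer. There exists an integer $N=N(k)$ such that for every integer $n\geq N$ and every connected graph $G$ of order $n$ the following hold. (i) $S_k(D(G))\geq n-k$, and equality holds if and only if $G\cong K_n$. (ii) If $G$ is a tree, then $S_k(D(G))\geq 2n-2k$, and equality holds if and only if $G\cong K_{1,n-1}$.
   Context: All graphs are finite, simple, undirected and connected; the order of a graph is its number of vertices. For a connected graph $G$ with vertex set $\{v_1,\dots,v_n\}$, the distance $d_G(v_i,v_j)$ is the length of a shortest path from $v_i$ to $v_j$, and the distance matrix $D(G)$ is the real symmetric $n\times n$ matrix whose $(i,j)$-entry is $d_G(v_i,v_j)$. Its eigenvalues, with multiplicity, are written $\lambda_1(D(G))\geq\lambda_2(D(G))\geq\cdots\geq\lambda_n(D(G))$, and $S_k(D(G))=\lambda_1(D(G))+\cdots+\lambda_k(D(G))$. $K_n$ is the complete graph on $n$ vertices and $K_{1,n-1}$ is the star on $n$ vertices. The phrase ''$n$ is sufficiently large with respect to $k$'' is expressed by the existence of a threshold $N(k)$ depending only on $k$. *)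

(* Defs.v *)
From mathcomp Require Import all_boot all_order all_algebra.
From mathcomp Require Import polyrcf.
From mathcomp Require Import reals.

Set Implicit Arguments.
Unset Strict Implicit.
Unset Printing Implicit Defensive.

Import Order.TTheory GRing.Theory Num.Theory.

Local Open Scope ring_scope.

Record sgraph := SGraph {
  vertex :> finType;
  adj : rel vertex;
  adj_sym : symmetric adj;
  adj_irrefl : irreflexive adj }.

Definition gconnected (G : sgraph) : Prop :=
  forall x y : G, connect (@adj G) x y.

(* A cycle of G is a cyclic sequence of at least 3 pairwise distinct vertices. *)
Definition acyclic (G : sgraph) : Prop :=
  forall c : seq G, (2 < size c)%N -> uniq c -> ~~ cycle (@adj G) c.

Definition is_tree (G : sgraph) : Prop := gconnected G /\ acyclic G.

Definition giso (G H : sgraph) : Prop :=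
  exists2 f : G -> H, bijective f & {mono f : x y / @adj G x y >-> @adj H x y}.

Definition complete_adj (n : nat) : rel 'I_n := fun i j => i != j.

Fact complete_adj_sym n : symmetric (@complete_adj n).
Proof. by move=> i j; rewrite /complete_adj eq_sym. Qed.

Fact complete_adj_irrefl n : irreflexive (@complete_adj n).
Proof. by move=> i; rewrite /complete_adj eqxx. Qed.

Definition complete_graph (n : nat) : sgraph :=
  SGraph (@complete_adj_sym n) (@complete_adj_irrefl n).

Definition bipartite_adj (m n : nat) : rel ('I_m + 'I_n)%type :=
  fun u v => is_inl u != is_inl v.

Fact bipartite_adj_sym m n : symmetric (@bipartite_adj m n).
Proof. by move=> u v; rewrite /bipartite_adj eq_sym. Qed.

Fact bipartite_adj_irrefl m n : irreflexive (@bipartite_adj m n).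
Proof. by move=> u; rewrite /bipartite_adj eqxx. Qed.

Definition complete_bipartite (m n : nat) : sgraph :=
  SGraph (@bipartite_adj_sym m n) (@bipartite_adj_irrefl m n).

(* [x :: p] is a path from x to y of length m, without repeated vertices. *)
Definition has_path (G : sgraph) (x y : G) (m : nat) : bool :=
  [exists p : m.-tuple G,
    [&& path (@adj G) x p, last x p == y & uniq (x :: p)]].

(* The least m with [has_path x y m]; such an m is always < #|G|, and the
   value is #|G| when there is no path from x to y. *)
Definition gdist (G : sgraph) (x y : G) : nat :=
  find (has_path x y) (iota 0 #|G|).

Definition dist_mx (R : realType) (G : sgraph) : 'M[R]_#|G| :=
  \matrix_(i, j) (gdist (enum_val i) (enum_val j))%:R.

(* The real eigenvalues of A in non-increasing order, each repeated according
   to its multiplicity as a root of the characteristic polynomial. All n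
   eigenvalues are listed when A is symmetric. *)
Definition eigenvalues (R : realType) (n : nat) (A : 'M[R]_n) : seq R :=
  sort >=%R (flatten [seq nseq (mup x (char_poly A)) x
                     | x <- rootsR (char_poly A)]).

Definition sum_eigenvalues (R : realType) (n : nat) (k : nat) (A : 'M[R]_n) : R :=
  \sum_(i < k) (eigenvalues A)`_i.

(* Main.v *)
Require Import Defs.
From mathcomp Require Import all_boot all_order all_algebra.
From mathcomp Require Import reals polyrcf complex perm.
From mathcomp Require Import zify ring lra.

(** The lower bounds come from the Ky Fan maximum principle: for a symmetric
    matrix, the sum of the k largest eigenvalues is at least the sum of the
    Rayleigh quotients of any k nonzero, pairwise orthogonal vectors (lemmas
    [kyfan] and [kyfan_seq]).  The test vectors are the constant function 1,
    whose Rayleigh quotient is W/n where W is the sum of all distances over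
    ordered pairs, and the differences e_a - e_b for disjoint pairs {a, b},
    whose Rayleigh quotient is - d(a, b).  Hence, for k - 1 disjoint pairs,
    S_k >= W/n - (sum of their distances) ([wiener_pairs_bound]).

    For (i), W >= n (n - 1), strictly if G is not complete, so k - 1 disjoint
    edges suffice.  If a greedy choice of k - 1 disjoint edges fails, then all
    edges meet a set F of at most 2 (k - 2) vertices; almost all distances are
    then at least 2, W/n is at least 2n - O(k), and k - 1 disjoint pairs at
    distance at most 2, which exist by the pigeonhole principle, suffice.

    For (ii), a tree has at most n - 1 edges, so W >= 2 (n - 1)^2.  A tree that
    is not a star contains a path a - u - v - b.  If k >= 3, the disjoint edges
    {a, u} and {v, b}, completed with k - 3 pairs at distance at most 2, give
    S_k > 2n - 2k.  If k = 2 only the pair {u, v} is used, and the missing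
    amount comes from pairs at distance at least 3: every vertex other than u
    and v is that far from a or from b ([far_pairs_tree]).

    For the complete graph and the star, D + I and D + 2I are positive
    semidefinite.  All eigenvalues are thus at least - t with t = 1 or 2, and
    since the trace of D vanishes, S_k <= t (n - k) ([sum_eigenvalues_le]).
    For the star the test vectors are e_c and 1 - e_c, c being the centre,
    and k - 2 pairs of leaves. *)

Set Implicit Arguments.
Unset Strict Implicit.
Unset Printing Implicit Defensive.

Import Order.TTheory GRing.Theory Num.Theory.

Local Open Scope ring_scope.

(** * Eigenvalues of a real symmetric matrix *)

Lemma mup_prod_XsubC (F : fieldType) (x : F) (s : seq F) :
  mup x (\prod_(a <- s) ('X - a%:P)) = count_mem x s.
Proof.
elim: s => [|a s IHs]; first by rewrite big_nil mupNroot // root1.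
rewrite big_cons mupM ?polyXsubC_eq0 //; last by rewrite monic_neq0 ?monic_prod_XsubC.
by rewrite IHs -['X - a%:P]expr1 mup_XsubCX /=; case: eqP.
Qed.

(** When the characteristic polynomial splits over R, [eigenvalues] lists its
    roots with the right multiplicities. *)
Lemma perm_eigenvalues (R : realType) n (A : 'M[R]_n) (s : seq R) :
  char_poly A = \prod_(a <- s) ('X - a%:P) -> perm_eq (eigenvalues A) s.
Proof.
move=> cA; rewrite /eigenvalues perm_sort cA.
set p := \prod_(_ <- _) _.
have p0 : p != 0 by rewrite monic_neq0 ?monic_prod_XsubC.
apply/allP => x _ /=; apply/eqP.
rewrite count_flatten -map_comp.
have memr : (x \in rootsR p) = (x \in s).
  by rewrite -roots_on_rootsR // inE /= root_prod_XsubC.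
rewrite (eq_map (g := fun y => if y == x then count_mem x s else 0%N)); last first.
  move=> y /=; rewrite mup_prod_XsubC count_nseq /=.
  by have [->|] := eqVneq y x; rewrite ?mul1n.
have ur : uniq (rootsR p).
  by rewrite (sorted_uniq (@lt_trans _ _) (@ltxx _ _)) ?sorted_roots.
rewrite sumnE big_map -big_mkcond /=.
case: (boolP (x \in s)) => xs.
  by rewrite -big_filter filter_pred1_uniq ?memr // big_seq1.
rewrite (count_memPn xs) big1_seq // => y /andP[/eqP->]; by rewrite memr (negPf xs).
Qed.

Lemma char_poly_similar (F : comNzRingType) n (P Q A : 'M[F]_n) :
  Q *m P = 1%:M -> char_poly (Q *m A *m P) = char_poly A.
Proof.
move=> QP; rewrite /char_poly.
have -> : char_poly_mx (Q *m A *m P) =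
    map_mx polyC Q *m char_poly_mx A *m map_mx polyC P.
  rewrite /char_poly_mx mulmxBr mulmxBl -!map_mxM /=; congr (_ - _).
  by rewrite scalar_mxC -mulmxA -map_mxM QP map_mx1 mulmx1.
by rewrite !det_mulmx mulrAC -det_mulmx -map_mxM QP map_mx1 det1 mul1r.
Qed.

Lemma sum_enum_rank (V : nmodType) (T : finType) (F : 'I_#|T| -> V) :
  \sum_i F i = \sum_x F (enum_rank x).
Proof.
by rewrite (reindex_onto enum_rank enum_val) => [|i _]; rewrite ?enum_valK //=;
  apply: eq_bigl => x; rewrite enum_rankK eqxx.
Qed.

Local Notation RePart := complex.Re.
Local Notation ImPart := complex.Im.

Section QuadraticForms.

Local Open Scope sesquilinear_scope.

Variables (R : realType) (T : finType).
Implicit Types (f g : T -> R) (B : T -> T -> R).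

(** The standard inner product of real functions on T. *)
Definition dot f g : R := \sum_x f x * g x.

(** The quadratic form of the kernel B. *)
Definition quad B f : R := \sum_x \sum_y f x * B x y * f y.

(** The matrix of the kernel B in the enumeration of T; [dist_mx R G] is, by
    conversion, the matrix of the distance kernel. *)
Definition fun_mx B : 'M[R]_#|T| := \matrix_(i, j) B (enum_val i) (enum_val j).

Lemma sum_quad (I : finType) (w : I -> R) (X Y : I -> T -> R) f :
  quad (fun x y => \sum_j w j * (X j x * X j y + Y j x * Y j y)) f
    = \sum_j w j * (dot f (X j) ^+ 2 + dot f (Y j) ^+ 2).
Proof.
rewrite /quad.
under eq_bigr => x _ do under eq_bigr => y _ do rewrite mulr_sumr mulr_suml.
under eq_bigr => x _ do rewrite exchange_big /=.
rewrite exchange_big /=; apply: eq_bigr => j _.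
rewrite !expr2 /dot !big_distrlr /= -big_split /= mulr_sumr.
apply: eq_bigr => x _; rewrite -big_split /= mulr_sumr.
by apply: eq_bigr => y _; ring.
Qed.

(** The spectral theorem for a real symmetric kernel, in a form which stays
    over R.  The matrix is diagonalized over R[i] by a unitary matrix Q, and
    X j, Y j are the real and imaginary parts of the j-th row of Q, so that
    the square of the modulus of <f, Q_j> is <f, X j>^2 + <f, Y j>^2 for a real
    function f. *)
Lemma spectral_quad B : (forall x y, B x y = B y x) ->
  exists (l : 'I_#|T| -> R) (X Y : 'I_#|T| -> T -> R),
  [/\ [/\ perm_eq (eigenvalues (fun_mx B)) [seq l j | j <- enum 'I_#|T|],
      forall j, dot (X j) (X j) + dot (Y j) (Y j) = 1
    & forall j, quad B (X j) + quad B (Y j) = l j],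
      \sum_j l j = \sum_x B x x,
      forall f, dot f f = \sum_j (dot f (X j) ^+ 2 + dot f (Y j) ^+ 2)
    & forall f, quad B f =
        \sum_j l j * (dot f (X j) ^+ 2 + dot f (Y j) ^+ 2)].
Proof.
move=> symB.
pose A := map_mx (real_complex R) (fun_mx B).
have rA : A \is a realmx.
  apply/mxOverP => i j; rewrite !mxE; by apply/complex_realP; exists (B (enum_val i) (enum_val j)).
have sA : A \is symmetricmx.
  apply/is_hermitianmxP; rewrite expr0 scale1r map_mx_id //.
  by apply/matrixP => i j; rewrite !mxE symB.
have nA : A \is normalmx by exact: symmetric_normalmx.

pose Q := spectralmx A; pose D := spectral_diag A.
have uQ : Q \is unitarymx by exact: spectral_unitarymx.
have QQ : Q *m Q^t* = 1%:M by exact/unitarymxP.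
have QQ' : Q^t* *m Q = 1%:M by exact: mulmx1C.
have AE : A = Q^t* *m diag_mx D *m Q.
  by rewrite -(invmx_unitary uQ); exact: (orthomx_spectralP nA).

have DE : Q *m A *m Q^t* = diag_mx D.
  by rewrite AE !mulmxA QQ mul1mx -mulmxA QQ mulmx1.
have rD j : D 0 j = (RePart (D 0 j))%:C%C.
  rewrite RRe_real //; have /mxOverP := hermitian_spectral_diag_real (realsym_hermsym sA rA).
  by apply.
pose l j := RePart (D 0 j).
pose X j x := RePart (Q j (enum_rank x)); pose Y j x := ImPart (Q j (enum_rank x)).
have conjE (z w : R[i]%C) : RePart (z^*%C * w) = RePart z * RePart w + ImPart z * ImPart w.
  by case: z w => [a b] [c d] /=; ring.
have ReD : {morph (@complex.Re R) : z w / z + w} by move=> [a b] [c d].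
have Re_sum (I : finType) (F : I -> R[i]%C) : RePart (\sum_i F i) = \sum_i RePart (F i).
  by apply: (big_morph _ ReD).
have ReZ (z : R[i]%C) a : RePart (z * a%:C%C) = a * RePart z.
  by case: z => b c /=; ring.
have QtE i j : Q^t* i j = (Q j i)^*%C by rewrite !mxE.
have deltaE x y : \sum_j (X j x * X j y + Y j x * Y j y) = (x == y)%:R.
  have := congr1 (fun M : 'M_ _ => RePart (M (enum_rank x) (enum_rank y))) QQ'.
  rewrite !mxE (inj_eq enum_rank_inj) Re_sum.
  under eq_bigr => j _ do rewrite QtE conjE.
  by move=> ->; case: (x == y).
have BE x y : B x y = \sum_j l j * (X j x * X j y + Y j x * Y j y).
  have := congr1 (fun M : 'M_ _ => RePart (M (enum_rank x) (enum_rank y))) AE.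
  rewrite !mxE !enum_rankK /= => ->; rewrite Re_sum; apply: eq_bigr => j _.
  rewrite mul_mx_diag mxE QtE rD -/(l j) -conjE mulrAC.
  by rewrite ReZ.
have normE j : dot (X j) (X j) + dot (Y j) (Y j) = 1.
  have := congr1 (fun M : 'M_ _ => RePart (M j j)) QQ.
  rewrite [(_ *m _) j j]mxE [1%:M j j]mxE eqxx Re_sum /= => <-.
  rewrite -big_split sum_enum_rank /=; apply: eq_bigr => x _.
  by rewrite QtE [Q _ _ * _]mulrC conjE.
exists l, X, Y; split; first split.
- apply: perm_eigenvalues; rewrite big_map big_enum /=.
  apply: (map_poly_inj (real_complex R)).
  rewrite map_char_poly -/A.
  have -> : char_poly A = char_poly (diag_mx D).
    by rewrite AE char_poly_similar //.
  rewrite char_poly_trig ?diag_mx_is_trig // rmorph_prod; apply: eq_bigr => j _.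
  by rewrite rmorphB /= map_polyX map_polyC mxE eqxx mulr1n rD.
- exact: normE.
- move=> j; have := congr1 (fun M : 'M_ _ => RePart (M j j)) DE.
  rewrite [diag_mx _ j j]mxE eqxx mulr1n -/(l j) => <-.
  rewrite -mulmxA [(_ *m _) j j]mxE Re_sum sum_enum_rank /quad -big_split /=.
  apply: eq_bigr => x _; rewrite mxE sum_enum_rank mulr_sumr Re_sum -big_split /=.
  apply: eq_bigr => y _; rewrite QtE !mxE !enum_rankK [_%:C%C * _]mulrC mulrA.
  by rewrite ReZ [Q _ _ * _]mulrC conjE /X /Y; ring.
- under eq_bigr => j _ do rewrite -[l j]mulr1 -(normE j).
  under [RHS]eq_bigr => x _ do rewrite BE.
  rewrite exchange_big /=; apply: eq_bigr => j _.
  by rewrite -mulr_sumr -big_split.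
- move=> f; transitivity (\sum_j 1 * (dot f (X j) ^+ 2 + dot f (Y j) ^+ 2)); last first.
    by apply: eq_bigr => j _; rewrite mul1r.
  have -> : dot f f = quad (fun x y => (x == y)%:R) f.
    apply: eq_bigr => x _; rewrite (bigD1 x) //= eqxx mulr1 big1 ?addr0 // => y.
    by rewrite eq_sym => /negPf->; rewrite mulr0 mul0r.
  rewrite -sum_quad; apply: eq_bigr => x _; apply: eq_bigr => y _.
  by rewrite -deltaE; under [in RHS]eq_bigr => j _ do rewrite mul1r.
- move=> f; rewrite -sum_quad.
  by apply: eq_bigr => x _; apply: eq_bigr => y _; rewrite BE.
Qed.

End QuadraticForms.

(** * The Ky Fan principle *)

Section KyFan.
Variables (R : realType) (T : finType).
Implicit Types (f g : T -> R) (B : T -> T -> R).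

Lemma dotC f g : dot f g = dot g f.
Proof. by apply: eq_bigr => x _; rewrite mulrC. Qed.

Lemma dot_ge0 f : 0 <= dot f f.
Proof. by apply: sumr_ge0 => x _; rewrite -expr2 sqr_ge0. Qed.

(** Bessel's inequality for an orthogonal, not normalized family. *)
Lemma bessel k (F : 'I_k -> T -> R) g :
  (forall i, 0 < dot (F i) (F i)) ->
  (forall i j, i != j -> dot (F i) (F j) = 0) ->
  \sum_i dot (F i) g ^+ 2 / dot (F i) (F i) <= dot g g.
Proof.
move=> F0 FO; pose a i := dot (F i) g / dot (F i) (F i).
pose p x := \sum_i a i * F i x; pose S := \sum_i dot (F i) g ^+ 2 / dot (F i) (F i).
have dot_p h : dot p h = \sum_i a i * dot (F i) h.
  rewrite /dot /p; under eq_bigr => x _ do rewrite mulr_suml.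
  rewrite exchange_big; apply: eq_bigr => i _; rewrite mulr_sumr.
  by apply: eq_bigr => x _; rewrite mulrA.
have pg : dot p g = S.
  by rewrite dot_p; apply: eq_bigr => i _; rewrite /a expr2 mulrAC.
have pp : dot p p = S.
  rewrite dot_p; apply: eq_bigr => i _.
  rewrite dotC dot_p (bigD1 i) //= big1 ?addr0 => [|j /FO->]; last by rewrite mulr0.
  by rewrite /a; field; rewrite gt_eqF.
(* The squared norm of g minus its projection p is |g|^2 - S. *)
rewrite -/S; have := dot_ge0 (fun x => g x - p x).
have -> : dot (fun x => g x - p x) (fun x => g x - p x)
    = dot g g - dot p g *+ 2 + dot p p.
  rewrite /dot -sumrMnl -sumrB -big_split /=.
  by apply: eq_bigr => x _; ring.
by rewrite pg pp mulr2n opprD addrA subrK subr_ge0.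
Qed.

(** A weighted sum of a non-increasing sequence, with weights in [0, 1] of
    total k, is largest when the weights sit on the k first terms. *)
Lemma sum_sorted_weights n k (s : seq R) (c : 'I_n -> R) :
  sorted >=%R s -> size s = n -> (k <= n)%N ->
  (forall i, 0 <= c i <= 1) -> \sum_i c i = k%:R ->
  \sum_(i < n) s`_i * c i <= \sum_(i < k) s`_i.
Proof.
(* The threshold t separates the k first terms from the others; for k = 0 it
   is the first term, which still dominates all the others. *)
move=> srt sz kn c01 ck; pose t := s`_k.-1.
have mono (i j : nat) : (i <= j < n)%N -> s`_j <= s`_i.
  case/andP=> ij jn; apply: (sorted_leq_nth (leT := >=%R)); rewrite ?inE ?sz ?(leq_ltn_trans ij) //.
- by move=> x y z /[swap]; apply: le_trans.
- by move=> x; apply: lexx.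
rewrite [leRHS](big_ord_widen n (nth 0 s) kn) [leRHS]big_mkcond /=.
rewrite -subr_ge0 -sumrB.
have zE : 0 = \sum_(i < n) t * ((if (i < k)%N then 1 else 0) - c i) :> R.
  rewrite -mulr_sumr sumrB ck -big_mkcond -(big_ord_widen n (fun=> 1) kn) /=.
  by rewrite sumr_const card_ord subrr mulr0.
rewrite [leLHS]zE; apply: ler_sum => i _; have /andP[c0 c1] := c01 i.
case: (ltnP i k) => [ik|ki]; last first.
  have := mono k.-1 i; rewrite -/t.
  have -> : (k.-1 <= i < n)%N by rewrite ltn_ord (leq_trans (leq_pred k)).
  move=> /(_ isT) h. nra.
have := mono i k.-1; rewrite -/t.
have -> : (i <= k.-1 < n)%N.
  by rewrite -ltnS (ltn_predK ik) ik (leq_trans _ kn) // ltn_predL (leq_ltn_trans _ ik).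
by move=> /(_ isT) ?; nra.
Qed.

(** The lower-bound half of the Ky Fan maximum principle, for orthogonal
    functions which need not be normalized.  The sum of the Rayleigh quotients
    is the sum of l_j c_j, where l_j are the eigenvalues and the weights c_j
    lie in [0, 1] by Bessel's inequality and add up to k. *)
Lemma kyfan B k (F : 'I_k -> T -> R) :
  (forall x y, B x y = B y x) ->
  (forall i, 0 < dot (F i) (F i)) ->
  (forall i j, i != j -> dot (F i) (F j) = 0) ->
  \sum_i quad B (F i) / dot (F i) (F i) <= sum_eigenvalues k (fun_mx B).
Proof.
move=> symB F0 FO.
have [l [X [Y [[pl nXY _] _ dE qE]]]] := spectral_quad symB.
pose c j := \sum_i (dot (F i) (X j) ^+ 2 + dot (F i) (Y j) ^+ 2) / dot (F i) (F i).
have c01 j : 0 <= c j <= 1.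
  rewrite sumr_ge0 => [|i _]; last by rewrite divr_ge0 ?dot_ge0 // addr_ge0 ?sqr_ge0.
  rewrite -(nXY j) /c; under eq_bigr => i _ do rewrite mulrDl.
  by rewrite big_split lerD //= bessel.
have ck : \sum_j c j = k%:R.
  rewrite exchange_big /= -[k in RHS]card_ord -sumr_const; apply: eq_bigr => i _.
  by rewrite -mulr_suml -dE divff // gt_eqF.
have kn : (k <= #|T|)%N.
  rewrite -(ler_nat R) -ck -[#|T| in leRHS]card_ord -sumr_const.
  by apply: ler_sum => j _; have /andP[] := c01 j.
have -> : \sum_i quad B (F i) / dot (F i) (F i) = \sum_j l j * c j.
  under eq_bigr => i _ do rewrite qE mulr_suml.
  rewrite exchange_big /=; apply: eq_bigr => j _; rewrite mulr_sumr.
  by apply: eq_bigr => i _; rewrite mulrA.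
set s := eigenvalues _ in pl *; rewrite /sum_eigenvalues -/s.
have sz : size s == #|T| by rewrite (perm_size pl) size_map -cardE card_ord.
have srt : sorted >=%R s by apply: sort_sorted => x y; apply: le_total.
have [p lp] : exists p : {perm 'I_#|T|}, forall j, l j = s`_(p j).
  move: pl; rewrite perm_sym -[s]/(tval (Tuple sz)) => /tuple_permP[p e].
  exists p => j; have := congr1 (nth 0 ^~ j) e.
  rewrite (nth_map j) ?size_enum_ord // nth_ord_enum (nth_map j) ?size_enum_ord //.
  by rewrite nth_ord_enum (tnth_nth 0).
under eq_bigr => j _ do rewrite lp.
rewrite (reindex_inj (@perm_inj _ p^-1)) /=.
under eq_bigr => j _ do rewrite permKV.
apply: sum_sorted_weights; rewrite ?(eqP sz) //.
by rewrite -ck [RHS](reindex_inj (@perm_inj _ p^-1)).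
Qed.

(** If B has zero diagonal and B + t I is positive semidefinite, then every
    eigenvalue is at least - t while the trace is 0: the k largest eigenvalues
    balance the n - k smallest ones. *)
Lemma sum_eigenvalues_le B k t :
  (forall x y, B x y = B y x) -> (forall x, B x x = 0) -> (k <= #|T|)%N ->
  (forall f, 0 <= quad B f + t * dot f f) ->
  sum_eigenvalues k (fun_mx B) <= t * (#|T|%:R - k%:R).
Proof.
move=> symB B0 kn psd.
have [l [X [Y [[pl nXY qXY] trl _ _]]]] := spectral_quad symB.
have lt j : - t <= l j.
  rewrite -qXY -[t]mulr1 -(nXY j).
  by have := psd (X j); have := psd (Y j); lra.
rewrite /sum_eigenvalues; set s := eigenvalues _ in pl *.
have sz : size s = #|T| by rewrite (perm_size pl) size_map -cardE card_ord.
have st i : (i < #|T|)%N -> - t <= s`_i.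
  rewrite -sz => /(mem_nth 0); rewrite (perm_mem pl) => /mapP[j _ ->]; exact: lt.
have : \sum_(i < #|T|) s`_i = 0.
  have l0 : \sum_j l j = 0 by rewrite trl big1.
  rewrite -[RHS]l0.
  rewrite -(big_mkord predT (nth 0 s)) -[in LHS]sz -(big_nth 0 predT id).
  by rewrite (perm_big _ pl) /= big_map big_enum.
rewrite -(big_mkord predT (fun i => s`_i)) (big_cat_nat (n := k)) //= big_mkord.
move/eqP; rewrite addr_eq0 => /eqP->.
rewrite -sumrN -natrB // mulr_natr -sumr_const_nat.
by apply: ler_sum_nat => i /andP[_ ?]; rewrite lerNl st.
Qed.

End KyFan.

(** * Distances, degrees and disjoint pairs in a connected graph *)

(** The list of all endpoints of the pairs in ps; it is duplicate-free exactly
    when the pairs are disjoint and have distinct endpoints. *)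
Definition vertices (T : Type) (ps : seq (T * T)) : seq T :=
  flatten [seq [:: q.1; q.2] | q <- ps].

Section Distance.
Variable G : sgraph.
Implicit Types (x y z : G) (p : seq G).

Lemma gdist_le x y p :
  path (@adj G) x p -> last x p = y -> uniq (x :: p) -> (gdist x y <= size p)%N.
Proof.
move=> xp lp up; rewrite /gdist leqNgt; apply/negP => lt.
have sp : (size p < #|G|)%N by have := max_card (mem (x :: p)); rewrite (card_uniqP up).
have := before_find 0%N lt; rewrite nth_iota // add0n => /negbT/negP; apply.
rewrite /has_path.
by apply/existsP; exists (in_tuple p); rewrite /= xp lp eqxx.
Qed.

Lemma gdist_path x y : connect (@adj G) x y ->
  exists p, [/\ path (@adj G) x p, last x p = y, uniq (x :: p) & size p = gdist x y].
Proof.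
case/connectP => p0 /shortenP[p xp up _] ->.
have sp : (size p < #|G|)%N by have := max_card (mem (x :: p)); rewrite (card_uniqP up).
have hp : has (has_path x (last x p)) (iota 0 #|G|).
  apply/hasP; exists (size p); first by rewrite mem_iota.
  by rewrite /has_path; apply/existsP; exists (in_tuple p); rewrite /= xp eqxx.
have := nth_find 0%N hp; rewrite -/(gdist _ _).
have := hp; rewrite has_find size_iota -/(gdist _ _) => lt.
rewrite nth_iota // add0n => /existsP[q /and3P[xq /eqP lq uq]].
by exists q; rewrite size_tuple.
Qed.

Lemma gdistxx x : gdist x x = 0%N.
Proof. by apply/eqP; rewrite -leqn0 (gdist_le (p := [::])). Qed.

Lemma adj_neq x y : adj x y -> x != y.
Proof. by apply: contraTneq => ->; rewrite adj_irrefl. Qed.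

Hypothesis conG : gconnected G.

Lemma gdist_sym x y : gdist x y = gdist y x.
Proof.
suff le (a b : G) : (gdist a b <= gdist b a)%N by apply/eqP; rewrite eqn_leq !le.
have [p [bp lp up <-]] := gdist_path (conG b a).
rewrite -(size_belast b) -size_rev; apply: gdist_le.
- by rewrite -lp rev_path (eq_path (e' := @adj G)) // => u v; exact: adj_sym.
- by rewrite -lp; case: p {bp lp up} => //= c p; rewrite rev_cons last_rcons.
- by rewrite -lp -rev_rcons -lastI rev_uniq.
Qed.

Lemma gdist_gt0 x y : (0 < gdist x y)%N = (x != y).
Proof.
have [<-|xy] := eqVneq; first by rewrite gdistxx.
have [[|z p] [_ /= e _ <-]] // := gdist_path (conG x y).
by rewrite e eqxx in xy.
Qed.

Lemma gdist_adj x y : adj x y -> gdist x y = 1%N.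
Proof.
move=> xy; apply/eqP; rewrite eqn_leq gdist_gt0 adj_neq // andbT.
by apply: (gdist_le (p := [:: y])); rewrite /= ?andbT ?inE ?adj_neq.
Qed.

Lemma gdist_le1 x y : (gdist x y <= 1)%N -> x = y \/ adj x y.
Proof.
have [[|z [|t p]] [/= xz lz _ <-]] := gdist_path (conG x y) => // _; first by left.
by right; move: xz; rewrite lz andbT.
Qed.

Lemma gdist_le2 x y : (gdist x y <= 2)%N ->
  [\/ x = y, adj x y | exists2 z, adj x z & adj z y].
Proof.
have [[|z [|t [|s p]]] [/= xz lz _ <-]] := gdist_path (conG x y) => // _.
- by constructor 1.
- by constructor 2; move: xz; rewrite lz andbT.
by constructor 3; exists z; case/and3P: xz; rewrite ?lz // -lz.
Qed.

Lemma gdist_common x y z : adj x z -> adj z y -> (gdist x y <= 2)%N.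
Proof.
move=> xz zy; have [->|xy] := eqVneq x y; first by rewrite gdistxx.
apply: (gdist_le (p := [:: z; y])) => //=; first by rewrite xz zy.
by rewrite !inE !negb_or xy (adj_neq xz) (adj_neq zy).
Qed.

Lemma gdist_parent x y : x != y -> exists2 z, adj z y & (gdist x z < gdist x y)%N.
Proof.
move=> xy; have [p [xp lp up sp]] := gdist_path (conG x y).
case/lastP: p => [|p z] in xp lp up sp *; first by rewrite -lp eqxx in xy.
move: xp lp up sp; rewrite rcons_path last_rcons => /andP[xp lz] <- up <-.
exists (last x p) => //; rewrite size_rcons ltnS; apply: gdist_le => //.
by move: up; rewrite -rcons_cons rcons_uniq => /andP[].
Qed.

(** A vertex not adjacent to everything starts an induced path of length 2. *)
Lemma induced_path x : (exists2 y, y != x & ~~ adj x y) ->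
  exists y z, [/\ adj x y, adj y z, z != x & ~~ adj x z].
Proof.
case=> z0 z0x nz0.
have [m] := ubnP (gdist x z0); elim: m z0 z0x nz0 => // m IH z zx nz; rewrite ltnS => le.
have xz : x != z by rewrite eq_sym.
have [y yz lt] := gdist_parent xz.
have [xy|nxy] := boolP (adj x y); first by exists y, z.
apply: (IH y); rewrite ?nxy ?(leq_trans lt) //.
by apply: contraNneq nz => <-.
Qed.

Lemma has_neighbour x : (1 < #|G|)%N -> exists y, adj x y.
Proof.
move=> /card_gt1P[a [b [_ _ ab]]].
have [y xy] : exists y, x != y.
  by have [xa|] := eqVneq x a; [exists b; rewrite xa | exists a].
have [p [xp lp up sp]] := gdist_path (conG x y).
by case: p xp lp {up sp} => [_ /= e|z p /= /andP[xz _] _]; [rewrite e eqxx in xy | exists z].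
Qed.

(** The sum of the distances over all ordered pairs, that is, twice the Wiener
    index. *)
Definition wiener2 := (\sum_(x : G) \sum_(y : G) gdist x y)%N.
(** The number of ordered pairs of adjacent vertices. *)
Definition degree_sum := (\sum_(x : G) \sum_(y : G) @adj G x y)%N.
(** The number of ordered pairs of vertices at distance at least 3. *)
Definition far_pairs := (\sum_(x : G) \sum_(y : G) (2 < gdist x y))%N.

Lemma sum_neq : (\sum_(x : G) \sum_(y : G) (x != y) = #|G| * #|G|.-1)%N.
Proof.
rewrite -[in RHS]sum_nat_const; apply: eq_bigr => x _.
rewrite -(cardC1 x) -sum1_card [RHS]big_mkcond /=; apply: eq_bigr => y _.
by rewrite !inE eq_sym; case: eqP.
Qed.

(** For distinct x and y, the distance is at least 1 for an edge, 2 for a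
    non-edge and 3 for a far pair. *)
Lemma wiener2_ge : (2 * (#|G| * #|G|.-1) + far_pairs <= wiener2 + degree_sum)%N.
Proof.
rewrite -sum_neq /far_pairs /wiener2 /degree_sum big_distrr -!big_split /=.
apply: leq_sum => x _; rewrite big_distrr -!big_split /=; apply: leq_sum => y _.
have [->|xy] := eqVneq x y; first by rewrite gdistxx.
have [a|na] := boolP (adj x y); first by rewrite gdist_adj.
have : (1 < gdist x y)%N.
  by rewrite ltnNge; apply/negP => /gdist_le1[e|a]; [rewrite e eqxx in xy | rewrite a in na].
by case: ltnP; lia.
Qed.

Lemma degree_sum_noncomplete x y : x != y -> ~~ adj x y ->
  (degree_sum < #|G| * #|G|.-1)%N.
Proof.
move=> xy nxy; rewrite -sum_neq /degree_sum.
have le a b : (@adj G a b <= (a != b))%N by have := @adj_neq a b; case: adj => // ->.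
rewrite (bigD1 x) //= [ltnRHS](bigD1 x) //= -addSn; apply: leq_add; last first.
  by apply: leq_sum => a _; apply: leq_sum => b _.
rewrite (bigD1 y) //= [ltnRHS](bigD1 y) //= (negPf nxy) xy add0n add1n ltnS.
by apply: leq_sum => b _.
Qed.

(** If F covers all the edges, there are at most n |F| of them. *)
Lemma degree_sum_cover (F : {set G}) :
  (forall x y, x \notin F -> y \notin F -> ~~ adj x y) ->
  (degree_sum <= 2 * (#|G| * #|F|))%N.
Proof.
move=> cov; apply: (@leq_trans (\sum_(x : G) \sum_(y : G) ((x \in F) + (y \in F)))).
  apply: leq_sum => x _; apply: leq_sum => y _.
  by case: (boolP (x \in F)) => xF; case: (boolP (y \in F)) => yF;
    rewrite ?(negPf (cov _ _ xF yF)) //; case: adj.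
have sF : (\sum_(y : G) (y \in F) = #|F|)%N.
  rewrite -sum1_card [RHS]big_mkcond.
  by apply: eq_bigr => y _; case: (y \in F).
under eq_bigr => x _ do rewrite big_split /= sum_nat_const sF.
by rewrite big_split /= -big_distrr /= sF sum_nat_const mul2n -addnn.
Qed.

(** If no set of at most M vertices meets all the r-related pairs, then
    disjoint r-related pairs avoiding F can be picked one after the other. *)
Lemma greedy_pairs (r : rel G) M :
  (forall F : {set G}, (#|F| <= M)%N ->
     exists x y, [/\ x \notin F, y \notin F, x != y & r x y]) ->
  forall j (F : {set G}), (#|F| + j.*2 <= M.+2)%N ->
  exists ps, [/\ size ps = j, uniq (vertices ps), {in ps, forall q, r q.1 q.2}
    & {in vertices ps, forall x, x \notin F}].
Proof.
move=> ex; elim=> [|j IH] F le; first by exists [::].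
have [|x [y [xF yF xy rxy]]] := ex F; first by lia.
have [|ps [sp up rp dp]] := IH (x |: (y |: F)).
  by rewrite !cardsU1; case: (x \notin _); case: (y \notin _); lia.
exists ((x, y) :: ps); split.
- by rewrite /= sp.
- rewrite /= up inE negb_or xy /= andbT.
  by apply/andP; split; apply/negP => /dp; rewrite !inE eqxx ?orbT.
- by move=> p; rewrite inE => /predU1P[->|/rp].
- move=> z; rewrite /= !inE => /or3P[/eqP->|/eqP->|/dp] //.
  by rewrite !inE !negb_or => /and3P[].
Qed.

(** Outside a set F of less than half of the vertices there are two vertices at
    distance at most 2: otherwise choosing a neighbour for each vertex would
    inject the complement of F into F. *)
Lemma exists_near (F : {set G}) : (1 < #|G|)%N -> (2 * #|F| < #|G|)%N ->
  exists x y, [/\ x \notin F, y \notin F, x != y & (gdist x y <= 2)%N].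
Proof.
move=> G1 FG.
have /fin_all_exists[nb nbP] x := has_neighbour x G1.
have [/existsP[x /andP[xF nF]]|/existsPn nex] :=
  boolP [exists x, (x \notin F) && (nb x \notin F)].
  by exists x, (nb x); rewrite adj_neq // gdist_adj.
have /dinjectivePn[x xF [y /andP[yx yF] exy]] : ~~ dinjectiveb nb (mem (~: F)).
  apply/negP => /dinjectiveP inj.
  have /subset_leq_card : [set nb x | x in ~: F] \subset F.
    apply/subsetP => _ /imsetP[x xF ->]; have := nex x.
    by rewrite -in_setC xF /= negbK.
  rewrite card_in_imset //; have := cardsC F; lia.
exists x, y; rewrite -!in_setC xF yF eq_sym yx; split => //.
by apply: (@gdist_common _ _ (nb x)); rewrite // exy adj_sym.
Qed.

End Distance.

(** * Trees *)

Section Tree.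
Variable G : sgraph.
Implicit Types (x y z u v w : G).
Hypotheses (conG : gconnected G) (acyG : acyclic G).

(** Adjacency in the graph G with the edge uv removed. *)
Definition del_edge u v : rel G :=
  fun x y => adj x y && ~~ ((x == u) && (y == v) || (x == v) && (y == u)).

Lemma del_edge_sym u v : connect_sym (del_edge u v).
Proof.
apply: sym_connect_sym => x y; rewrite /del_edge adj_sym; congr (_ && ~~ _).
by rewrite orbC; congr (_ || _); rewrite andbC.
Qed.

(** In an acyclic graph every edge is a bridge. *)
Lemma bridge u v : adj u v -> ~~ connect (del_edge u v) u v.
Proof.
move=> uv; apply/negP => /connectP[p0 /shortenP[p up Up _] lv].
have upG : path (@adj G) u p by apply: sub_path up => x y /andP[].
case: p => [|a [|b p]] in up Up lv upG *.
- by have := adj_neq uv; rewrite lv eqxx.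
- by move: up; rewrite lv /del_edge /= !eqxx /= andbF.
have /negP := acyG (c := [:: u, a, b & p]) isT Up; apply.
by rewrite /cycle rcons_path upG -lv adj_sym.
Qed.

Lemma triangle_free u v w : adj u v -> adj v w -> adj u w -> False.
Proof.
move=> uv vw uw; have := bridge uw; move/negP; apply.
have [uv' vw'] := (adj_neq uv, adj_neq vw).
apply: (connect_trans (y := v)); apply: connect1; rewrite /del_edge ?uv ?vw eqxx /=.
  by rewrite (negPf vw') (negPf (adj_neq uw)).
by rewrite [v == u]eq_sym (negPf uv') (negPf vw').
Qed.

(** A path of length at most 2 using the edge uv has u or v as an endpoint;
    hence vertices other than u and v that are separated by the removal of uv
    are at distance at least 3. *)
Lemma far_across u v x y : x != u -> x != v -> y != u -> y != v ->
  ~~ connect (del_edge u v) x y -> (2 < gdist x y)%N.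
Proof.
move=> xu xv yu yv; apply: contraNT; rewrite -leqNgt.
have ex z : adj x z -> del_edge u v x z.
  by rewrite /del_edge (negPf xu) (negPf xv) andbT.
have ey z : adj z y -> del_edge u v z y.
  by rewrite /del_edge (negPf yu) (negPf yv) !andbF andbT.
case/(gdist_le2 conG) => [->|/ex|[z /ex xz /ey zy]]; first exact: connect0.
  exact: connect1.
by apply: connect_trans (connect1 zy); apply: connect1.
Qed.

(** If u is not farther than v from the root r, then a shortest path from u to
    r avoids v. *)
Lemma connect_root r u v : (gdist r u <= gdist r v)%N -> u != v ->
  connect (fun x y => [&& adj x y, x != v & y != v]) u r.
Proof.
have [m] := ubnP (gdist r u); elim: m u => // m IH u; rewrite ltnS => um uv nuv.
have [<-|ru] := eqVneq r u; first exact: connect0.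
have [w wu lt] := gdist_parent conG ru.
have wv : w != v by apply: contraTneq lt => ->; rewrite -leqNgt.
apply: connect_trans (IH w _ _ wv); last 2 first.
- exact: leq_trans lt um.
- exact: leq_trans (ltnW lt) uv.
by apply: connect1; rewrite adj_sym wu nuv wv.
Qed.

(** Two distinct neighbours u, w of v not farther than v from r would both be
    connected to r without v, so that uv would not be a bridge. *)
Lemma down_neighbours_le1 r v :
  (\sum_u (adj u v && (gdist r u <= gdist r v)) <= (v != r))%N.
Proof.
have [->|vr] := eqVneq v r.
  rewrite big1 // => u _; rewrite gdistxx leqNgt gdist_gt0 //.
  by have [->|] := eqVneq r u; rewrite ?adj_irrefl ?andbF.
rewrite (eq_bigr (fun u => if adj u v && (gdist r u <= gdist r v)%N then 1%N else 0%N)); last first.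
  by move=> u _; case: (_ && _).
rewrite -big_mkcond sum1_card; apply/card_le1_eqP => u w.
rewrite !unfold_in /= => /andP[uv ru] /andP[wv rw].
apply/eqP/negPn/negP => uw; have /negP := bridge uv; apply.
pose e := fun x y => [&& adj x y, x != v & y != v].
have sub x y : connect e x y -> connect (del_edge u v) x y.
  apply: connect_sub => {}x {}y /and3P[xy xv yv]; apply: connect1.
  by rewrite /del_edge xy (negPf xv) (negPf yv) !andbF.
apply: (connect_trans (y := r)); first by rewrite sub // connect_root // adj_neq.
apply: (connect_trans (y := w)).
  by rewrite del_edge_sym sub // connect_root // adj_neq.
apply: connect1; rewrite /del_edge wv eqxx andbT (negPf uw) /=.
by rewrite (negPf (adj_neq wv)).
Qed.

Lemma degree_sum_tree : (degree_sum G <= 2 * #|G|.-1)%N.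
Proof.
have [r _|G0] := pickP (mem G); last first.
  by rewrite /degree_sum big1 // => x; have := G0 x.
(* E counts the ordered pairs (u, v) of adjacent vertices with u not farther
   than v from r; every edge is counted at least once. *)
pose E := (\sum_v \sum_u (adj u v && (gdist r u <= gdist r v)))%N.
have EG : (E <= #|G|.-1)%N.
  apply: (@leq_trans (\sum_v (v != r))).
    by apply: leq_sum => v _; apply: down_neighbours_le1.
  rewrite -(cardC1 r) -sum1_card [leqRHS]big_mkcond /=; apply: leq_sum => v _.
  by rewrite !inE; case: eqP.
suff : (degree_sum G <= E + E)%N by lia.
rewrite {2}/E exchange_big -big_split; apply: leq_sum => v _ /=.
rewrite -big_split; apply: leq_sum => u _ /=; rewrite [adj u v]adj_sym.
by case: adj => //=; case: (leqP (gdist r u)) => // h; rewrite (ltnW h).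
Qed.

(** Every vertex other than u and v is at distance at least 3 from a or from b,
    since a and b lie on different sides of the bridge uv.  This gives n - 2
    ordered far pairs, and one more because a or b has two far vertices. *)
Lemma far_pairs_tree a u v b : (4 < #|G|)%N ->
  adj a u -> adj u v -> adj v b -> a != v -> b != u -> (#|G|.-1 <= far_pairs G)%N.
Proof.
move=> G5 au uv vb av bu.
have [[au' uv'] vb'] := (adj_neq au, adj_neq uv, adj_neq vb).
pose e := del_edge u v.
have ca : connect e a u.
  by apply: connect1; rewrite /e /del_edge au (negPf au') (negPf av).
have cb : connect e b v.
  apply: connect1; rewrite /e /del_edge adj_sym vb (negPf bu).
  by rewrite [b == v]eq_sym (negPf vb').
have nab : ~~ connect e a b.
  apply: contra (bridge uv) => ab; apply: connect_trans cb.
  by apply: connect_trans ab; rewrite del_edge_sym.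
have far w : w != u -> w != v -> (2 < gdist w a)%N || (2 < gdist w b)%N.
  move=> wu wv; have [wa|nwa] := boolP (connect e w a); last first.
    by rewrite (far_across wu wv au' av nwa).
  rewrite orbC (far_across (u := u) (v := v)) // 1?[b == v]eq_sym //.
  by apply: contra nab; apply: connect_trans; rewrite del_edge_sym.
have fab : (2 < gdist a b)%N by rewrite (far_across (u := u) (v := v)) // eq_sym.
(* The other far vertex of c is a or b, and w is taken outside {u, v, a, b}. *)
have [c cuv c2] : exists2 c, (c != u) && (c != v) &
    (2 <= \sum_y (2 < gdist c y))%N.
  have [w] : exists w, w \notin (u |: (v |: (a |: [set b]))).
    apply/existsP; rewrite -negb_forall; apply: contraTN G5 => /forallP all.
    rewrite -leqNgt -cardsT (_ : [set: G] = u |: (v |: (a |: [set b]))); last first.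
      by apply/setP => x; rewrite inE all.
    by rewrite !cardsU1 cards1; do !case: (_ \notin _).
  rewrite !inE !negb_or => /and4P[wu wv wa wb].
  have two x y z : y != z -> (2 < gdist x y)%N -> (2 < gdist x z)%N ->
      (2 <= \sum_t (2 < gdist x t))%N.
    by move=> yz xy xz; rewrite (bigD1 y) //= (bigD1 z) 1?eq_sym //= xy xz.
  have /orP[f|f] := far w wu wv.
    exists a; rewrite ?au' //; apply: (two _ w b) => //.
    by rewrite gdist_sym.
  exists b; rewrite ?bu 1?eq_sym //.
  by apply: (two _ w a) => //; rewrite gdist_sym.
apply: (@leq_trans (\sum_w ((w != u) && (w != v) + (w == c)))).
  have one z : (\sum_w (w == z) = 1)%N.
    by rewrite (bigD1 z) //= eqxx big1 // => w /negPf->.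
  rewrite big_split /= one.
  suff : (#|G| <= \sum_w ((w != u) && (w != v)) + (1 + 1))%N.
    by rewrite addnA addn1; case: #|G|.
  rewrite -{1}(one u) -[X in (_ + (_ + X))%N](one v) -!big_split -sum1_card; apply: leq_sum => w _ /=.
  by case: (w == u); case: (w == v).
apply: leq_sum => w _; have [->|wc] := eqVneq w c; first by rewrite cuv.
rewrite addn0; case: (boolP (_ && _)) => // /andP[wu wv].
by have /orP[f|f] := far w wu wv; [rewrite (bigD1 a) | rewrite (bigD1 b)]; rewrite //= f.
Qed.

End Tree.

(** * Test functions supported on pairs, and general connected graphs *)

Section TestFunctions.
Variables (R : realType) (T : finType).
Implicit Types (f g : T -> R) (B : T -> T -> R) (p q : T * T).

Lemma kyfan_seq B (fs : seq (T -> R)) :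
  (forall x y, B x y = B y x) ->
  all (fun f => 0 < dot f f) fs ->
  pairwise (fun f g => dot f g == 0) fs ->
  \sum_(f <- fs) quad B f / dot f f <= sum_eigenvalues (size fs) (fun_mx B).
Proof.
move=> symB pos orth; pose f0 : T -> R := fun=> 0.
rewrite (big_nth f0) big_mkord; apply: (kyfan (F := fun i => nth f0 fs i)) => //.
  by move=> i; apply: (all_nthP f0 pos).
have lt_orth i j : (i < j < size fs)%N -> dot (nth f0 fs i) (nth f0 fs j) = 0.
  case/andP=> ij js; apply/eqP.
  by apply: (pairwiseP f0 orth) => //; rewrite inE (ltn_trans ij).
move=> i j; rewrite neq_ltn => /orP[ij|ji]; first by rewrite lt_orth ?ij /=.
by rewrite dotC lt_orth ?ji /=.
Qed.

(** The test function e_a - e_b of the pair p = (a, b). *)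
Definition pair_fun p (x : T) : R := (x == p.1)%:R - (x == p.2)%:R.

Lemma sum_delta (F : T -> R) y : \sum_x (x == y)%:R * F x = F y.
Proof.
by rewrite (bigD1 y) //= eqxx mul1r big1 ?addr0 // => x /negPf->; rewrite mul0r.
Qed.

Lemma dot_pair p f : dot (pair_fun p) f = f p.1 - f p.2.
Proof.
rewrite /dot; under eq_bigr => x _ do rewrite mulrBl.
by rewrite sumrB !sum_delta.
Qed.

Lemma quad_dot B f : quad B f = dot f (fun x => dot f (B x)).
Proof.
apply: eq_bigr => x _; rewrite mulr_sumr; apply: eq_bigr => y _.
by rewrite -mulrA [B x y * _]mulrC.
Qed.

Lemma mem_vertices p ps : p \in ps -> (p.1 \in vertices ps) && (p.2 \in vertices ps).
Proof. by move=> pps; apply/andP; split; apply/flatten_mapP; exists p; rewrite // !inE eqxx ?orbT. Qed.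

(** Ky Fan's bound for functions hs completed with the functions e_a - e_b of
    disjoint pairs {a, b}; orthogonality between the two groups means that each
    h in hs takes the same value at a and at b. *)
Lemma kyfan_pairs B (hs : seq (T -> R)) (ps : seq (T * T)) :
  (forall x y, B x y = B y x) -> (forall x, B x x = 0) ->
  all (fun h => 0 < dot h h) hs -> pairwise (fun f g => dot f g == 0) hs ->
  (forall p, p \in ps -> all (fun h => h p.1 == h p.2) hs) ->
  uniq (vertices ps) ->
  \sum_(h <- hs) quad B h / dot h h - \sum_(p <- ps) B p.1 p.2
    <= sum_eigenvalues (size hs + size ps) (fun_mx B).
Proof.
move=> symB B0 pos orth hps up.
have pair_val q : q.1 != q.2 -> dot (pair_fun q) (pair_fun q) = 2 /\
    quad B (pair_fun q) / dot (pair_fun q) (pair_fun q) = - B q.1 q.2.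
  move=> q12; have e : dot (pair_fun q) (pair_fun q) = 2.
    by rewrite dot_pair /pair_fun !eqxx [q.2 == _]eq_sym (negPf q12) /=; ring.
  split => //; rewrite e quad_dot !dot_pair !B0 [B q.2 _]symB; by field.
suff [pos' orth' ->] : [/\ all (fun f => 0 < dot f f) [seq pair_fun p | p <- ps],
    pairwise (fun f g => dot f g == 0) [seq pair_fun p | p <- ps]
  & - \sum_(p <- ps) B p.1 p.2 =
    \sum_(f <- [seq pair_fun p | p <- ps]) quad B f / dot f f].
  rewrite -(size_map pair_fun ps) -size_cat -big_cat; apply: kyfan_seq => //.
    by rewrite all_cat pos.
  rewrite pairwise_cat orth orth' /allrel !andbT.
  elim: hs {pos orth} hps => //= h hs IH hps; apply/andP; split; last first.
    by apply: IH => p /hps /andP[].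
  rewrite all_map; apply/allP => p /hps /andP[/eqP e _] /=.
  by rewrite dotC dot_pair e subrr.
elim: ps up {hps} => [|p ps IH] /=; first by rewrite !big_nil oppr0.
rewrite inE negb_or => /and3P[/andP[p12 p1] p2 /IH[-> -> e]].
have [d2 qv] := pair_val _ p12.
rewrite !big_cons -e qv d2 opprD ltr0n; split=> //; rewrite andbT all_map.
apply/allP => q /mem_vertices /andP[q1 q2] /=; rewrite dot_pair /pair_fun.
have ne x y : x \notin vertices ps -> y \in vertices ps -> (x == y) = false.
  by move=> nx iny; apply: contraNF nx => /eqP->.
by rewrite !ne // !subrr.
Qed.

End TestFunctions.

Section DistanceSpectrum.
Variables (R : realType) (G : sgraph).
Hypothesis conG : gconnected G.
Implicit Types (x y z c : G) (ps : seq (G * G)).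

Let D x y : R := (gdist x y)%:R.

Let D_sym x y : D x y = D y x.
Proof. by rewrite /D gdist_sym. Qed.

Let D0 x : D x x = 0.
Proof. by rewrite /D gdistxx. Qed.

Lemma sum_gdist_le d ps : {in ps, forall p, (gdist p.1 p.2 <= d)%N} ->
  \sum_(p <- ps) D p.1 p.2 <= (d * size ps)%:R.
Proof.
move=> le; rewrite -natr_sum ler_nat.
elim: ps le => [|p ps IH] le; first by rewrite big_nil.
rewrite big_cons mulnS leq_add ?le ?mem_head // IH // => q qps.
by rewrite le // inE qps orbT.
Qed.

(** The case of [kyfan_pairs] where hs consists of the constant function 1. *)
Lemma wiener_pairs_bound ps : (0 < #|G|)%N -> uniq (vertices ps) ->
  (wiener2 G)%:R / #|G|%:R - \sum_(p <- ps) D p.1 p.2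
    <= sum_eigenvalues (size ps).+1 (dist_mx R G).
Proof.
move=> G0 up; pose h : G -> R := fun=> 1.
have hh : dot h h = #|G|%:R.
  by rewrite /dot; under eq_bigr => x _ do rewrite mulr1; rewrite sumr_const.
have hq : quad D h = (wiener2 G)%:R.
  rewrite /quad /wiener2 natr_sum; apply: eq_bigr => x _; rewrite natr_sum.
  by apply: eq_bigr => y _; rewrite mul1r mulr1.
have := kyfan_pairs (hs := [:: h]) D_sym D0 _ _ _ up.
rewrite big_seq1 hh hq => /= H; apply: H => //; first by rewrite hh ltr0n G0.
by move=> p _; rewrite eqxx.
Qed.

Lemma exists_outside (F : {set G}) : (#|F| + 2 <= #|G|)%N ->
  exists x y, [/\ x \notin F, y \notin F, x != y & true].
Proof.
move=> FG; have /card_gt1P[x [y [xF yF xy]]] : (1 < #|~: F|)%N.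
  by have := cardsC F; lia.
by exists x, y; rewrite -!in_setC.
Qed.

Lemma sum_eigenvalues_complete k : (2 * k <= #|G|)%N -> (0 < k)%N ->
  (forall x y, x != y -> adj x y) ->
  sum_eigenvalues k (dist_mx R G) = #|G|%:R - k%:R.
Proof.
move=> kG k0 com.
have DE x y : D x y = 1 - (x == y)%:R.
  rewrite /D; have [->|/com xy] := eqVneq x y; first by rewrite gdistxx subrr.
  by rewrite gdist_adj // subr0.
apply/le_anti/andP; split.
  rewrite -[leRHS]mul1r; apply: (sum_eigenvalues_le (B := D)) => //; first by lia.
  move=> f; rewrite mul1r.
  suff -> : quad D f + dot f f = (\sum_x f x) ^+ 2 by rewrite sqr_ge0.
  rewrite expr2 big_distrlr /quad /dot -big_split; apply: eq_bigr => x _ /=.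
  under eq_bigr => y _ do rewrite DE mulrBr mulr1 mulrBl.
  rewrite sumrB -[X in _ - _ + X]mul1r -addrA -[RHS]addr0; congr (_ + _).
  under eq_bigr => y _ do rewrite [_ * (x == y)%:R]mulrC [x == y]eq_sym -mulrA.
  by rewrite sum_delta mul1r addNr.
have ex (F : {set G}) : (#|F| <= #|G| - 2)%N ->
    exists x y, [/\ x \notin F, y \notin F, x != y & true].
  by move=> FG; apply: exists_outside; lia.
have [|ps [sp up _ _]] := greedy_pairs ex (j := k.-1) (F := set0).
  by rewrite cards0; lia.
have G0 : (0 < #|G|)%N by lia.
have low := wiener_pairs_bound G0 up; rewrite sp prednK // in low.
apply: le_trans low.
have -> : (wiener2 G)%:R / #|G|%:R = #|G|.-1%:R :> R.
  have -> : wiener2 G = (#|G| * #|G|.-1)%N.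
    rewrite -sum_neq; apply: eq_bigr => x _; apply: eq_bigr => y _.
    have [->|/com] := eqVneq x y; [exact: gdistxx | exact: gdist_adj].
  by rewrite natrM mulrC mulKf // pnatr_eq0 -lt0n.
have le : \sum_(p <- ps) D p.1 p.2 <= (1 * size ps)%:R.
  apply: sum_gdist_le => p _; have [->|/com ?] := eqVneq p.1 p.2; first by rewrite gdistxx.
  by rewrite gdist_adj.
rewrite mul1n sp in le.
have e1 : #|G|%:R = #|G|.-1%:R + 1 :> R by rewrite natr1 prednK.
have e2 : k%:R = k.-1%:R + 1 :> R by rewrite natr1 prednK.
by lra.
Qed.

Lemma sum_eigenvalues_noncomplete k : (2 <= k)%N -> (6 * k <= #|G|)%N ->
  (exists x y, x != y /\ ~~ adj x y) ->
  #|G|%:R - k%:R < sum_eigenvalues k (dist_mx R G).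
Proof.
move=> k2 kG [x [y [xy nxy]]].
have G0 : (0 < #|G|)%N by lia.
have nG0 : 0 < #|G|%:R :> R by rewrite ltr0n.
have Wge : (2 * (#|G| * #|G|.-1) <= wiener2 G + degree_sum G)%N.
  by have := wiener2_ge conG; lia.
(* The bound W/n - s (k - 1) for pairs at distance at most s, where W/n is
   larger than the integer m. *)
have fin (m : nat) ps (s : nat) : (m * #|G| < wiener2 G)%N ->
    size ps = k.-1 -> uniq (vertices ps) ->
    {in ps, forall p, (gdist p.1 p.2 <= s)%N} -> (#|G| + s * k.-1 <= m + k)%N ->
    #|G|%:R - k%:R < sum_eigenvalues k (dist_mx R G).
  move=> mW sp up near le; have := wiener_pairs_bound G0 up.
  rewrite sp prednK; last by lia.
  apply: lt_le_trans; have := sum_gdist_le near; rewrite sp => le2.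
  have lt1 : m%:R < (wiener2 G)%:R / #|G|%:R :> R.
    by rewrite ltr_pdivlMr // -natrM ltr_nat.
  by move: le; rewrite -(ler_nat R) !natrD; lra.
have [/forallP ex|] := boolP [forall F : {set G}, (#|F| <= 2 * k.-2)%N ==>
  [exists x, exists y, [&& x \notin F, y \notin F & adj x y]]].
  have exA (F : {set G}) : (#|F| <= 2 * k.-2)%N ->
      exists a b, [/\ a \notin F, b \notin F, a != b & adj a b].
    move=> FM; have /implyP/(_ FM)/existsP[a /existsP[b /and3P[aF bF ab]]] := ex F.
    by exists a, b; rewrite adj_neq.
  have [|ps [sp up adjp _]] := greedy_pairs exA (j := k.-1) (F := set0).
    by rewrite cards0; lia.
  apply: (fin #|G|.-1 ps 1%N) => //.
  - by have := degree_sum_noncomplete xy nxy; nia.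
  - by move=> p /adjp /gdist_adj->.
  - by lia.
(* Otherwise a small set F covers all the edges. *)
rewrite negb_forall => /existsP[F]; rewrite negb_imply => /andP[FM nF].
have cov a b : a \notin F -> b \notin F -> ~~ adj a b.
  move=> aF bF; apply: contra nF => ab.
  by apply/existsP; exists a; apply/existsP; exists b; rewrite aF bF.
have := degree_sum_cover cov => dF.
have exN (E : {set G}) : (#|E| <= 2 * k.-2)%N ->
    exists a b, [/\ a \notin E, b \notin E, a != b & (gdist a b <= 2)%N].
  by move=> EM; apply: exists_near => //; lia.
have [|ps [sp up near _]] := greedy_pairs exN (j := k.-1) (F := set0).
  by rewrite cards0; lia.
apply: (fin (#|G| + k.-1) ps 2%N) => //; last by lia.
nia.
Qed.

End DistanceSpectrum.

(** * Stars and trees that are not stars *)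

Section StarSpectrum.
Variables (R : realType) (G : sgraph).
Hypothesis conG : gconnected G.
Implicit Types (x y z c : G) (ps : seq (G * G)).

(** G is the star with centre c: the edges are exactly the pairs of c and
    another vertex. *)
Definition star_centre c := forall x y, adj x y = ((x == c) != (y == c)).

Let D x y : R := (gdist x y)%:R.

Lemma gdist_star c x y : star_centre c ->
  D x y = 2 - (x == c)%:R - (y == c)%:R + 2 * ((x == c)%:R * (y == c)%:R)
          - 2 * (x == y)%:R.
Proof.
move=> sc; rewrite /D; have [->|xy] := eqVneq x y.
  by rewrite gdistxx; case: (y == c) => /=; ring.
have := sc x y; have [xc|xc] := eqVneq x c; have [yc|yc] := eqVneq y c => /= a.
- by rewrite xc yc eqxx in xy.
- by rewrite gdist_adj //; ring.
- by rewrite gdist_adj //; ring.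
suff -> : gdist x y = 2%N by ring.
apply/eqP; rewrite eqn_leq (gdist_common (z := c)) ?sc ?eqxx ?xc ?yc ?(negPf xc) ?(negPf yc) //=.
rewrite ltnNge; apply/negP => /(gdist_le1 conG)[e|]; last by rewrite a.
by rewrite e eqxx in xy.
Qed.

(** Up to the diagonal, the distance kernel of a star has rank 2: the form only
    depends on the total sum of f, on f c and on the norm of f. *)
Lemma quad_star c (f : G -> R) : star_centre c ->
  quad D f = 2 * (\sum_x f x) ^+ 2 - 2 * f c * (\sum_x f x) + 2 * f c ^+ 2
             - 2 * dot f f.
Proof.
move=> sc; set t := \sum_x f x.
have row x : \sum_y f x * D x y * f y =
    2 * t * f x - t * ((x == c)%:R * f x) - f c * f x
    + 2 * f c * ((x == c)%:R * f x) - 2 * (f x * f x).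
  under eq_bigr => y _ do rewrite (gdist_star _ _ sc).
  rewrite (eq_bigr (fun y => 2 * f x * f y - (x == c)%:R * f x * f y
     - f x * ((y == c)%:R * f y) + 2 * ((x == c)%:R * f x) * ((y == c)%:R * f y)
     - 2 * f x * ((y == x)%:R * f y))); last by move=> y _; rewrite [x == y]eq_sym; ring.
  rewrite sumrB big_split /= !sumrB -!mulr_sumr !sum_delta -/t; ring.
rewrite /quad; under eq_bigr => x _ do rewrite row.
rewrite sumrB big_split /= !sumrB -!mulr_sumr !sum_delta -/t -/(dot f f); ring.
Qed.

Lemma sum_eigenvalues_star k c : (2 <= k)%N -> (2 * k <= #|G|)%N -> star_centre c ->
  sum_eigenvalues k (dist_mx R G) = 2 * #|G|%:R - 2 * k%:R.
Proof.
move=> k2 kG sc.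
have D_sym x y : D x y = D y x by rewrite /D gdist_sym.
have D0 x : D x x = 0 by rewrite /D gdistxx.
apply/le_anti/andP; split.
  rewrite -mulrBr; apply: (sum_eigenvalues_le (B := D)) => //; first by lia.
  move=> f; rewrite (quad_star _ sc); set t := \sum_x _; set d := dot f f.
  have -> : 2 * t ^+ 2 - 2 * f c * t + 2 * f c ^+ 2 - 2 * d + 2 * d
     = t ^+ 2 + f c ^+ 2 + (t - f c) ^+ 2 by ring.
  by rewrite !addr_ge0 ?sqr_ge0.
have ex (F : {set G}) : (#|F| <= #|G| - 2)%N ->
    exists x y, [/\ x \notin F, y \notin F, x != y & true].
  by move=> FG; apply: exists_outside; lia.
have [|ps [sp up _ nc]] := greedy_pairs ex (j := k.-2) (F := [set c]).
  by rewrite cards1; lia.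
pose h0 x : R := (x == c)%:R; pose h1 x : R := (x != c)%:R.
have n1 : \sum_x h1 x = #|G|%:R - 1.
  have -> : \sum_x h1 x = \sum_x (1 - (x == c)%:R * 1).
    by apply: eq_bigr => x _; rewrite /h1; case: (x == c) => /=; ring.
  by rewrite sumrB sum_delta sumr_const.
have n0 : \sum_x h0 x = 1.
  by rewrite -(sum_delta (fun=> 1) c); apply: eq_bigr => x _; rewrite mulr1.
have d00 : dot h0 h0 = 1 by rewrite /dot sum_delta /h0 eqxx.
have d01 : dot h0 h1 = 0 by rewrite /dot sum_delta /h1 eqxx.
have d11 : dot h1 h1 = #|G|%:R - 1.
  by rewrite -n1; apply: eq_bigr => x _; rewrite /h1; case: (x == c); rewrite ?mulr0 ?mulr1.
have nG : 1 < #|G|%:R :> R by rewrite ltr1n; lia.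
have low := kyfan_pairs (B := D) (hs := [:: h0; h1]) D_sym D0 _ _ _ up.
have {low} := low; rewrite /= d00 d01 d11 eqxx ltr01 subr_gt0 nG => /(_ isT isT).
move=> low; have {low} := low _; rewrite sp.
have -> : (2 + k.-2)%N = k by lia.
rewrite !big_cons big_nil addr0 !(quad_star _ sc) n0 n1 d00 d11 /h0 /h1 eqxx /=.
move=> low; apply: le_trans (low _); last first.
  move=> p /mem_vertices /andP[/nc p1 /nc p2]; move: p1 p2.
  by rewrite !inE => /negPf-> /negPf->; rewrite !eqxx.
have le : \sum_(p <- ps) D p.1 p.2 <= (2 * size ps)%:R.
  apply: sum_gdist_le => // p _; rewrite -(ler_nat R) -/(D _ _) (gdist_star _ _ sc).
  by case: (p.1 == c); case: (p.2 == c); case: (p.1 == p.2) => /=; lra.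
rewrite sp in le.
have -> : k%:R = k.-2%:R + 2 :> R.
  by rewrite -natrD (_ : (k.-2 + 2)%N = k) //; lia.
rewrite natrM in le.
suff -> : (2 * (#|G|%:R - 1) ^+ 2 - 2 * 0 * (#|G|%:R - 1) + 2 * 0 ^+ 2
      - 2 * (#|G|%:R - 1)) / (#|G|%:R - 1) = 2 * #|G|%:R - 4 :> R by lra.
by field; rewrite subr_eq0 gt_eqF.
Qed.

Lemma sum_eigenvalues_nonstar k : acyclic G -> (2 <= k)%N -> (6 * k + 5 <= #|G|)%N ->
  (forall c, ~ star_centre c) ->
  2 * #|G|%:R - 2 * k%:R < sum_eigenvalues k (dist_mx R G).
Proof.
move=> acG k2 kG ns.
have G0 : (0 < #|G|)%N by lia.
(* In an acyclic graph a vertex adjacent to all the others is the centre of a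
   star, so here no vertex is. *)
have nondom x : exists2 y, y != x & ~~ adj x y.
  have [/existsP[y /andP[yx nxy]]|/existsPn dom] :=
    boolP [exists y, (y != x) && ~~ adj x y]; first by exists y.
  have {}dom y : y != x -> adj x y.
    by move=> yx; have := dom y; rewrite yx negbK.
  case: (ns x) => y z; have [->|yx] := eqVneq y x; have [->|zx] := eqVneq z x => //=.
  - by rewrite adj_irrefl.
  - exact: dom.
  - by rewrite adj_sym dom.
  by apply/negP => yz; apply: (triangle_free acG (dom y yx) yz (dom z zx)).
have [a [u [v [b [au uv vb av bu]]]]] : exists a u v b,
    [/\ adj a u, @adj G u v, adj v b, a != v & b != u].
  have /card_gt0P[x _] := G0.
  have [u [z [xu uz zx _]]] := induced_path conG (nondom x).
  have [v [b [uv vb bu _]]] := induced_path conG (nondom u).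
  have [xv|xv] := eqVneq x v; last by exists x, u, v, b.
  by exists z, u, v, b; split; rewrite // -?xv // adj_sym.
have ab : a != b.
  apply/negP => /eqP e; apply: (triangle_free acG uv vb).
  by rewrite -e adj_sym.
have W1 := wiener2_ge conG; have W2 := degree_sum_tree conG acG.
have nG0 : 0 < #|G|%:R :> R by rewrite ltr0n.
(* The bound W/n - s for k - 1 pairs with sum of distances at most s, where
   W/n is larger than the integer m. *)
have fin (m : nat) ps : (m * #|G| < wiener2 G)%N ->
    size ps = k.-1 -> uniq (vertices ps) ->
    forall s : nat, \sum_(p <- ps) D p.1 p.2 <= s%:R -> (2 * #|G| + s <= m + 2 * k)%N ->
    2 * #|G|%:R - 2 * k%:R < sum_eigenvalues k (dist_mx R G).
  move=> mW sp up s ls le; have := wiener_pairs_bound R conG G0 up.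
  rewrite sp prednK; last by lia.
  apply: lt_le_trans.
  have lt1 : m%:R < (wiener2 G)%:R / #|G|%:R :> R.
    by rewrite ltr_pdivlMr // -natrM ltr_nat.
  by move: le; rewrite -(ler_nat R) !natrD; lra.
have [k_2|k3] : k = 2%N \/ (2 < k)%N by lia.
  have G5 : (4 < #|G|)%N by lia.
  have far := far_pairs_tree conG acG G5 au uv vb av bu.
  apply: (fin (2 * #|G| - 3)%N [:: (u, v)] _ _ _ 1%N).
  - by have := far; nia.
  - by rewrite k_2.
  - by rewrite /= inE adj_neq.
  - by rewrite big_seq1 /D gdist_adj.
  by rewrite k_2; lia.
have exN (E : {set G}) : (#|E| <= 2 * k)%N ->
    exists x y, [/\ x \notin E, y \notin E, x != y & (gdist x y <= 2)%N].
  by move=> EM; apply: exists_near => //; lia.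
pose F := a |: (u |: (v |: [set b])).
have FC : (#|F| <= 4)%N by rewrite !cardsU1 cards1; do !case: (_ \notin _).
have [|ps [sp up near dis]] := greedy_pairs exN (j := k - 3) (F := F).
  by lia.
apply: (fin (2 * #|G| - 4)%N [:: (a, u), (v, b) & ps] _ _ _ (2 + 2 * (k - 3))%N).
- by nia.
- by rewrite /= sp; lia.
- have nin x : x \in F -> x \notin vertices ps.
    by apply: contraL => /dis.
  rewrite /= !inE !negb_or up !nin /F ?inE ?eqxx ?orbT //.
  by rewrite (adj_neq au) av ab (adj_neq uv) [u == b]eq_sym bu (adj_neq vb).
- rewrite !big_cons /D !gdist_adj // natrD addrA lerD //.
  by have := sum_gdist_le R near; rewrite sp.
lia.
Qed.

End StarSpectrum.

(** * Isomorphism with complete graphs and stars *)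

Lemma giso_complete (G : sgraph) n : #|G| = n ->
  giso G (complete_graph n) <-> (forall x y : G, x != y -> adj x y).
Proof.
move=> Gn; split=> [[f fbij fmono] x y xy|com].
  by rewrite -fmono /= /complete_adj (bij_eq fbij).
exists (fun x => cast_ord Gn (enum_rank x)).
  apply: bij_comp; last exact: enum_rank_bij.
  by exists (cast_ord (esym Gn)); [apply: cast_ordK | apply: cast_ordKV].
move=> x y /=; rewrite /complete_adj (inj_eq (@cast_ord_inj _ _ _)) (inj_eq enum_rank_inj).
by have [->|/com->] := eqVneq x y; rewrite ?adj_irrefl.
Qed.

Lemma giso_star (G : sgraph) n : #|G| = n -> (0 < n)%N ->
  giso G (complete_bipartite 1 n.-1) <-> (exists c : G, star_centre c).
Proof.
move=> Gn n0; split=> [[f fbij fmono]|[c sc]].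
  have [g fg gf] := fbij; exists (g (inl ord0)) => x y; rewrite -fmono /= /bipartite_adj.
  have e z : (z == g (inl ord0)) = is_inl (f z).
    rewrite -(bij_eq fbij) gf; case: (f z) => // i; apply/eqP; congr inl.
    by rewrite (ord1 i).
  by rewrite !e.
pose s := enum (predC1 c).
have sz : size s = n.-1 by rewrite -cardE cardC1 Gn.
pose g (u : 'I_1 + 'I_n.-1) := if u is inr j then nth c s j else c.
have gc u : (g u == c) = is_inl u.
  case: u => [i|j] /=; first by rewrite eqxx.
  have : nth c s j \in s by rewrite mem_nth // sz.
  by rewrite mem_enum inE => /negPf.
have ginj : injective g.
  move=> u w e; have := gc u; rewrite e gc.
  case: u w e => [i|i] [j|j] //= e _; first by rewrite (ord1 i) (ord1 j).
  congr inr; apply/val_inj/eqP.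
  by rewrite -(nth_uniq c (s := s)) ?sz ?enum_uniq ?ltn_ord //; apply/eqP.
have gbij : bijective g.
  by apply: inj_card_bij => //; rewrite Gn card_sum !card_ord; lia.
have [f gf fg] := gbij; exists f; first by exists g.
by move=> x y /=; rewrite /bipartite_adj -!gc !fg sc.
Qed.

(** * The extremal graphs *)

Theorem theorem1 (R : realType) (k : nat) (hk : (2 <= k)%N) :
  exists N : nat, forall n : nat, (N <= n)%N ->
  forall G : sgraph, gconnected G -> #|G| = n ->
    (n%:R - k%:R <= sum_eigenvalues k (dist_mx R G) /\
     (sum_eigenvalues k (dist_mx R G) = n%:R - k%:R
        <-> giso G (complete_graph n))) /\
    (is_tree G ->
     2 * n%:R - 2 * k%:R <= sum_eigenvalues k (dist_mx R G) /\
     (sum_eigenvalues k (dist_mx R G) = 2 * n%:R - 2 * k%:R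
        <-> giso G (complete_bipartite 1 n.-1))).
Proof.
exists (6 * k + 5)%N => n nN G conG Gn; subst n; split.
  have Gk : (6 * k <= #|G|)%N by lia.
  have [/'forall_forallP com|] := boolP [forall x : G, forall y : G, (x != y) ==> adj x y].
    have {}com (x y : G) : x != y -> adj x y by move/implyP: (com x y).
    rewrite (sum_eigenvalues_complete R conG) //; try by lia.
    by split=> //; split=> // _; apply/(giso_complete (erefl _)).
  rewrite negb_forall => /existsP[x]; rewrite negb_forall => /existsP[y].
  rewrite negb_imply => /andP[xy nxy].
  have := sum_eigenvalues_noncomplete R conG hk Gk (ex_intro _ x (ex_intro _ y (conj xy nxy))).
  move=> lt; split; first exact: ltW.
  split=> [e|/(giso_complete (erefl _)) com]; first by rewrite e ltxx in lt.
  by rewrite com in nxy.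
case=> _ acG.
have n0 : (0 < #|G|)%N by lia.
have [/existsP[c /'forall_forallP sc]|ns] :=
  boolP [exists c : G, forall x : G, forall y : G, adj x y == ((x == c) != (y == c))].
  have {}sc : star_centre c by move=> x y; apply/eqP.
  rewrite (sum_eigenvalues_star R conG hk _ sc); last by lia.
  by split=> //; split=> // _; apply/(giso_star (erefl _))=> //; exists c.
have {}ns (c : G) : ~ star_centre c.
  move=> sc; move/existsPn/(_ c)/negP: ns; apply.
  by apply/'forall_forallP => x y; rewrite sc.
have := sum_eigenvalues_nonstar R conG acG hk _ ns => /(_ nN) lt.
split; first exact: ltW.
split=> [e|/(giso_star (erefl _) n0)[c /ns]] //; by rewrite e ltxx in lt.
Qed.
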